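(* Let $\mathcal F$ be a frame, let $\vec p$ be the probability vector with $p_n=(Cn^2)^{-1}$ for all $n\in\mathbb{N}$ (where $C=\sum_{n\ge1}n^{-2}$), and let $\Psi=\Psi(\mathcal F)$. Then for $\mathbb{P}_{\vec p}$-almost every $\omega\in\Omega$, $$\dim_H\big(J(\Psi(\omega))\big)<B(\Psi).$$ (More precisely, $\dim_H(J(\Psi(\omega)))=0$ a.s. while $B(\Psi)=d$.)
   Context: Let $d\ge1$, $X=[0,1]^d$, and $\boldsymbol e_1,\dots,\boldsymbol e_d$ the standard basis of $\mathbb{R}^d$. For $\boldsymbol i=(i_1,\dots,i_d)\in\{0,1\}^d$ let $\phi_{\boldsymbol i}(x)=\frac12x+\frac12\sum_{\ell=1}^d i_\ell\boldsymbol e_\ell$. Let $I_1=\{(0,\dots,0)\}$ and $I_{2^d}=\{0,1\}^d$. A frame is a pair $\mathcal F=(\{U_n\}_{n\in\mathbb{N}},\{V_n\}_{n\in\mathbb{N}})$ of sequences of positive integers with $U_1\ge1$ and, for all $n\in\mathbb{N}$, $nU_n\le V_n$ and $(U_n+V_n)^3\le U_{n+1}$. For $i\in\mathbb{N}$ let $I^{(i)}=I_1^{U_i}\times I_{2^d}^{V_i}$, for $\tau=(\tau_1,\dots,\tau_{U_i+V_i})\in I^{(i)}$ let $\psi^{(i)}_\tau=\phi_{\tau_1}\circ\cdots\circ\phi_{\tau_{U_i+V_i}}$ (contraction ratio $c^{(i)}_\tau=2^{-(U_i+V_i)}$), and $\Psi(\mathcal F)=\{\Psi^{(i)}\}_{i\in\mathbb{N}}$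 with $\Psi^{(i)}=\{\psi^{(i)}_\tau\}_{\tau\in I^{(i)}}$. $\mathbb{P}_{\vec p}$ is the Bernoulli measure on $\Omega=\mathbb{N}^{\mathbb{N}}$ with $\mathbb{P}([\omega_1\dots\omega_n])=p_{\omega_1}\cdots p_{\omega_n}$. For $\omega\in\Omega$, $\Sigma^n_\omega=\prod_{k=1}^nI^{(\omega_k)}$, $\psi^{(\omega)}_\tau=\psi^{(\omega_1)}_{\tau_1}\circ\cdots\circ\psi^{(\omega_n)}_{\tau_n}$, and $J(\Psi(\omega))=\bigcap_{n\ge1}\bigcup_{\tau\in\Sigma^n_\omega}\psi^{(\omega)}_\tau(X)$. The Bowen parameter is $B(\Psi)=\inf\{t\ge0:\sum_{i}p_i\log\sum_{\tau\in I^{(i)}}(c^{(i)}_\tau)^t\le0\}$, the series taken in $[-\infty,\infty]$. $\dim_H$ is Euclidean Hausdorff dimension. *)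

(* Defs.v *)
From HB Require Import structures.
From mathcomp Require Import all_boot all_order all_algebra.
From mathcomp Require Import all_classical all_reals all_analysis.
Set Implicit Arguments. Unset Strict Implicit. Unset Printing Implicit Defensive.
Import Order.TTheory GRing.Theory Num.Theory.
Import numFieldNormedType.Exports.
Local Open Scope classical_set_scope.
Local Open Scope ring_scope.

Section Defs.
Variable R : realType.

Definition pt (d : nat) := 'I_d -> R.

Definition edist (d : nat) (x y : pt d) : R :=
  Num.sqrt (\sum_(l < d) (x l - y l) ^+ 2).

Definition cost (d : nat) (s : R) (U : set (pt d)) : R :=
  if pselect (U !=set0)
  then (sup [set edist x y | x in U & y in U]) `^ s
  else 0.

Definition Hdelta (d : nat) (s delta : R) (A : set (pt d)) : \bar R :=
  ereal_inf [set (\sum_(0 <= j <oo) (cost s (Us j))%:E)%E |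
    Us in [set Us : nat -> set (pt d) |
      A `<=` \bigcup_j Us j /\
      (forall j x y, Us j x -> Us j y -> edist x y <= delta)]].

Definition Hmeas (d : nat) (s : R) (A : set (pt d)) : \bar R :=
  ereal_sup [set Hdelta s delta A | delta in [set delta : R | 0 < delta]].

Definition dimH (d : nat) (A : set (pt d)) : \bar R :=
  ereal_inf [set s%:E | s in [set s : R | 0 <= s /\ Hmeas s A = 0%E]].

Definition X (d : nat) : set (pt d) := [set x | forall l, 0 <= x l <= 1].

Definition letter (d : nat) := {ffun 'I_d -> bool}.
Definition zero_letter (d : nat) : letter d := [ffun => false].

Definition phi (d : nat) (a : letter d) (x : pt d) : pt d :=
  fun l => x l / 2 + (a l)%:R / 2.

Definition psi_word (d : nat) (w : seq (letter d)) : pt d -> pt d :=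
  foldr (fun a f => fun x => phi a (f x)) id w.

(* index 0 is unused: N = {1,2,...} *)
Definition is_frame (U V : nat -> nat) : Prop :=
  (1 <= U 1)%N /\
  (forall n, (0 < n)%N ->
     [/\ (0 < U n)%N, (0 < V n)%N, (n * U n <= V n)%N &
         ((U n + V n) ^ 3 <= U n.+1)%N]).

Definition inI (d : nat) (U V : nat -> nat) (i : nat) (w : seq (letter d)) : bool :=
  (size w == U i + V i)%N && all (fun a => a == zero_letter d) (take (U i) w).

Definition cratio (U V : nat -> nat) (i : nat) : R := (2^-1) ^+ (U i + V i).

Definition level_sum (d : nat) (U V : nat -> nat) (i : nat) (t : R) : R :=
  \sum_(tau : (U i + V i).-tuple (letter d) |
          all (fun a => a == zero_letter d) (take (U i) tau))
     (cratio U V i) `^ t.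

Definition Cst : R := limn (fun N => \sum_(1 <= n < N) ((n%:R) ^- 2 : R)).

(* p_n = (C n^2)^{-1} for n >= 1; index 0 (not in N) gets mass 0 *)
Definition pvec (n : nat) : R := if n == 0%N then 0 else (Cst * (n%:R) ^+ 2)^-1.

Definition cylinder (w : seq nat) : set (nat -> nat) :=
  [set om | forall k, (k < size w)%N -> om k = nth 0%N w k].

Definition cyl_prob (w : seq nat) : R := \prod_(a <- w) pvec a.

(* outer measure generated by the cylinder probabilities (Caratheodory);
   its null sets are exactly the null sets of (the completion of) P_p *)
Definition Pouter (A : set (nat -> nat)) : \bar R :=
  ereal_inf [set (\sum_(0 <= j <oo) (cyl_prob (ws j))%:E)%E |
    ws in [set ws : nat -> seq nat | A `<=` \bigcup_j cylinder (ws j)]].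

Definition almost_surely (Q : (nat -> nat) -> Prop) : Prop :=
  Pouter [set om | ~ Q om] = 0%E.

(* om k is omega_{k+1}; tau in Sigma^n_omega is a list of n words *)
Definition inSigma (d : nat) (U V : nat -> nat) (om : nat -> nat) (n : nat)
  (ts : seq (seq (letter d))) : Prop :=
  size ts = n /\ forall k, (k < n)%N -> inI U V (om k) (nth [::] ts k).

Definition Jset (d : nat) (U V : nat -> nat) (om : nat -> nat) : set (pt d) :=
  \bigcap_(n in [set n : nat | (1 <= n)%N])
    \bigcup_(ts in [set ts | inSigma U V om n ts])
      (psi_word (flatten ts) @` @X d).

Definition bowen_cond (d : nat) (U V : nat -> nat) (t : R) : Prop :=
  exists l : \bar R,
    ((fun n => \sum_(1 <= i < n) (pvec i * ln (level_sum d U V i t))%:E)%E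
       @ \oo --> l) /\ (l <= 0)%E.

Definition Bowen (d : nat) (U V : nat -> nat) : \bar R :=
  ereal_inf [set t%:E | t in [set t : R | 0 <= t /\ bowen_cond d U V t]].

End Defs.
Arguments Jset R d U V om : clear implicits.
Arguments dimH R d A : clear implicits.

(* Main.v *)
(* Almost surely, for every large m some letter >= m occurs among the first m^2
   letters of omega: the mass of the contrary event is at most r^m with r < 1, and
   Borel-Cantelli applies.  Before the first such letter there are at most m^2
   words, all of length at most W = U_(m-1) + V_(m-1), while the next word starts
   with at least U_m >= W^3 forced zeros.  Hence J is covered by at most
   2^(d m^2 W) cells of diameter at most sqrt d * 2^(-W^3), which gives H^s(J) = 0
   for every s > 0.  On the other hand the i-th term of the Bowen series is
   p_i ln 2 ((d - t) V_i - t U_i); it is <= 0 at t = d, and for t < d it is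
   eventually at least 1 since V_i >= i U_i and U_i >= i^3. *)
Require Import Defs.
From HB Require Import structures.
From mathcomp Require Import all_boot all_order all_algebra.
From mathcomp Require Import all_classical all_reals all_analysis.
From mathcomp Require Import zify ring lra.
Import Order.TTheory GRing.Theory Num.Theory.
Import numFieldNormedType.Exports.
Local Open Scope classical_set_scope.
Local Open Scope ring_scope.

(** * Nonnegative series indexed by concatenated lists *)

Lemma nneseries_le_partial (R : realType) (u : nat -> R) (e : R) :
  (forall n, 0 <= u n) -> (forall n, \sum_(j < n) u j <= e) ->
  (\sum_(0 <= j <oo) (u j)%:E <= e%:E)%E.
Proof.
move=> u0 ue; apply: lime_le.
  by apply: is_cvg_nneseries => n _ _; rewrite lee_fin.
by apply: nearW => n; rewrite sumEFin lee_fin big_mkord.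
Qed.

(* Lists [L m] are concatenated into a single sequence; the neutral element [z]
   is prepended to each of them so that the concatenation never runs out. *)
Lemma sequence_of_lists (R : realType) (T : eqType) (z : T) (L : nat -> seq T)
    (f : T -> R) (e : R) :
  (forall x, 0 <= f x) -> f z = 0 ->
  (forall n, \sum_(m < n) \sum_(x <- L m) f x <= e) ->
  exists ws : nat -> T,
    [/\ forall m x, x \in L m -> exists j, ws j = x,
        forall j, ws j = z \/ exists m, ws j \in L m &
        (\sum_(0 <= j <oo) (f (ws j))%:E <= e%:E)%E].
Proof.
move=> f0 fz Le.
pose F n := flatten [seq z :: L m | m <- iota 0 n].
have FS n : F n.+1 = F n ++ z :: L n.
  by rewrite /F -addn1 iotaD map_cat flatten_cat /= add0n cats0.
have sF n : (n <= size (F n))%N.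
  by elim: n => // n IH; rewrite FS size_cat /= addnS ltnS (leq_trans IH) ?leq_addr.
(* The lists [F n] extend one another, so entry [j] is already settled in [F j.+1]. *)
have pF j n : (j < n)%N -> nth z (F j.+1) j = nth z (F n) j.
  elim: n => // n IH; rewrite ltnS leq_eqVlt => /orP[/eqP->//|jn].
  by rewrite IH// FS nth_cat (leq_trans jn (sF n)).
exists (fun j => nth z (F j.+1) j); split.
- move=> m x xL.
  have xF : x \in F m.+1 by rewrite FS mem_cat inE xL !orbT.
  exists (index x (F m.+1)).
  rewrite (pF _ (maxn m.+1 (index x (F m.+1)).+1)) ?leq_maxr//.
  have [k ->] : exists k, F (maxn m.+1 (index x (F m.+1)).+1) = F m.+1 ++ k.
    move: (leq_maxl m.+1 (index x (F m.+1)).+1); move: (maxn _ _) => n mn.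
    exists (drop (size (F m.+1)) (F n)); elim: n mn => // n IH.
    rewrite leq_eqVlt => /orP[/eqP<-|]; first by rewrite drop_size cats0.
    rewrite ltnS => /IH e1; rewrite FS {2}e1 -catA drop_size_cat// catA.
    by rewrite -e1.
  by rewrite nth_cat index_mem xF nth_index.
- move=> j; have : nth z (F j.+1) j \in F j.+1 by rewrite mem_nth.
  move: (nth _ _ _) => x; elim: j.+1 => // n IH.
  rewrite FS mem_cat inE => /or3P[/IH//|/eqP|xL]; first by left.
  by right; exists n.
apply: nneseries_le_partial => // n.
have -> : \sum_(j < n) f (nth z (F j.+1) j) = \sum_(x <- take n (F n)) f x.
  rewrite (big_nth z) size_take_min (minn_idPl (sF n)) big_mkord.
  by apply: eq_bigr => j _; rewrite (pF j n)// nth_take.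
apply: le_trans (Le n).
have -> : \sum_(m < n) \sum_(x <- L m) f x = \sum_(x <- F n) f x.
  rewrite /F big_flatten/= big_map -[in RHS](subn0 n) -/(index_iota 0 n) big_mkord.
  by apply: eq_bigr => m _; rewrite big_cons fz add0r.
by rewrite -{2}(cat_take_drop n (F n)) big_cat/= lerDl sumr_ge0.
Qed.

(** * The normalising constant and the tails of the probability vector *)

(** Telescoping of [1/(x+1)^2 <= 1/x - 1/(x+1)]. The resulting bound 2 makes the partial sums
    converge, so that the limit defining [Cst] is a genuine one. *)
Lemma sum_inv_sqr_le (R : realType) (n : nat) :
  \sum_(1 <= k < n.+2) (k%:R ^- 2 : R) <= 2 - n.+1%:R^-1.
Proof.
elim: n => [|n IH]; first by rewrite big_nat1 expr1n invr1; lra.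
rewrite big_nat_recr//=; apply: le_trans (lerD IH (lexx _)) _.
have n0 : 0 < n.+1%:R :> R by rewrite ltr0n.
rewrite -(natr1 n.+1); move: n.+1%:R n0 => x x0.
have x1 : 0 < x + 1 by lra.
suff : (x + 1) ^- 2 <= x^-1 - (x + 1)^-1 by lra.
have -> : x^-1 - (x + 1)^-1 = (x * (x + 1))^-1 by field; rewrite !lt0r_neq0.
by rewrite lef_pV2 ?posrE ?mulr_gt0 ?exprn_gt0// expr2 ler_pM2r//; lra.
Qed.

Lemma sum_inv_sqr_le_Cst (R : realType) (n : nat) :
  \sum_(1 <= k < n) (k%:R ^- 2 : R) <= Cst R.
Proof.
set u := fun N => \sum_(1 <= k < N) (k%:R ^- 2 : R).
have u_homo : {homo u : a b / (a <= b)%N >-> a <= b}.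
  move=> a b ab; rewrite /u; have [a1|a1] := ltnP a 2.
    by rewrite big_geq ?sumr_ge0.
  by rewrite (big_cat_nat (ltnW a1) ab)//= lerDl sumr_ge0.
apply: (nondecreasing_cvgn_le (u_ := u)) => //.
apply: nondecreasing_is_cvgn => //.
exists 2 => _ [N _ <-]; apply: le_trans (u_homo _ _ (leq_addr 2 N)) _.
by rewrite /u addn2; apply: le_trans (sum_inv_sqr_le R N) _; rewrite lerBlDr lerDl invr_ge0.
Qed.

Lemma Cst_gt0 (R : realType) : 0 < Cst R.
Proof.
apply: lt_le_trans (sum_inv_sqr_le_Cst R 2).
by rewrite big_nat1 expr1n invr1.
Qed.

Lemma pvec_ge0 (R : realType) (i : nat) : 0 <= pvec R i.
Proof.
rewrite /pvec; case: ifP => // _.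
by rewrite invr_ge0 mulr_ge0 ?(ltW (Cst_gt0 R))// exprn_ge0.
Qed.

Lemma sum_pvec_le1 (R : realType) (n : nat) : \sum_(0 <= i < n) pvec R i <= 1.
Proof.
case: n => [|n]; first by rewrite big_geq.
rewrite big_nat_recl//= {1}/pvec/= add0r.
rewrite (eq_bigr (fun i => (Cst R)^-1 * i.+1%:R ^- 2)); last first.
  by move=> i _; rewrite /pvec/= invfM.
rewrite -mulr_sumr -[X in _ <= X](mulVf (lt0r_neq0 (Cst_gt0 R))).
rewrite ler_pM2l ?invr_gt0 ?Cst_gt0//.
apply: le_trans (sum_inv_sqr_le_Cst R n.+1).
by rewrite big_add1.
Qed.

(** The letters in [[m, 2m)] already take away enough mass: there are [m] of them, each of
    probability at least [1 / (C (2m)^2)]. *)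
Lemma sum_pvec_le (R : realType) (m : nat) : (0 < m)%N ->
  \sum_(0 <= i < m) pvec R i <= 1 - (4 * Cst R * m%:R)^-1.
Proof.
move=> m0; rewrite lerBrDr; apply: le_trans (sum_pvec_le1 R (m + m)).
rewrite [leRHS](big_cat_nat (n := m))//= ?leq_addr// lerD2l.
have C0 := Cst_gt0 R; have mR : 0 < m%:R :> R by rewrite ltr0n.
apply: (@le_trans _ _ (\sum_(m <= i < m + m) (Cst R * (2 * m%:R) ^+ 2)^-1)).
  rewrite big_const_nat addnK iter_addr addr0 -mulr_natr le_eqVlt; apply/orP; left.
  by apply/eqP; field; rewrite !lt0r_neq0.
apply: ler_sum_nat => i /andP[mi im].
have i0 : (0 < i)%N by exact: leq_trans mi.
rewrite /pvec gtn_eqF// lef_pV2 ?posrE ?mulr_gt0 ?exprn_gt0 ?ltr0n//.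
rewrite ler_pM2l// lerXn2r ?nnegrE ?mulr_ge0 ?ler0n//.
by rewrite -natrM ler_nat mul2n -addnn ltnW.
Qed.

(** * Borel-Cantelli for sequences whose letters stay small *)

(** The letter [0] is included because a sequence in [nat -> nat] may take it; it carries no
    mass. *)
Fixpoint words_below (m n : nat) : seq (seq nat) :=
  if n is n'.+1 then [seq a :: w | a <- index_iota 0 m, w <- words_below m n']
  else [:: [::]].

Lemma mem_words_below (m n : nat) (om : nat -> nat) :
  (forall k, (k < n)%N -> (om k < m)%N) -> mkseq om n \in words_below m n.
Proof.
elim: n om => // n IH om omm; rewrite /mkseq/= (iotaDl 1 0) -map_comp.
apply/allpairsP; exists (om 0%N, mkseq (om \o S) n); split => //=.
  by rewrite mem_index_iota omm.
by apply: IH => k kn; exact: omm.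
Qed.

Lemma sum_words_below (R : realType) (m n : nat) :
  \sum_(w <- words_below m n) cyl_prob R w = (\sum_(0 <= i < m) pvec R i) ^+ n.
Proof.
elim: n => [|n IH]; first by rewrite /= big_seq1 /cyl_prob big_nil.
rewrite /= big_allpairs_dep/= exprS -IH mulr_suml; apply: eq_bigr => a _.
by rewrite mulr_sumr; apply: eq_bigr => w _; rewrite /cyl_prob big_cons.
Qed.

Lemma cyl_prob_ge0 (R : realType) (w : seq nat) : 0 <= cyl_prob R w.
Proof. by rewrite /cyl_prob prodr_ge0// => i _; exact: pvec_ge0. Qed.

(** From [1 + x <= exp x]: the power [m^2] of [1 - 1/(4Cm)] is at most [exp(-m/(4C))]. The length
    [m^2] is what turns a deficit of order [1/m] into geometric decay. *)
Lemma sum_words_below_le (R : realType) (m : nat) : (0 < m)%N ->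
  \sum_(w <- words_below m (m ^ 2)) cyl_prob R w <= expR (- (4 * Cst R)^-1) ^+ m.
Proof.
move=> m0; rewrite sum_words_below -expRM_natl.
have C0 := Cst_gt0 R; have mR : 0 < m%:R :> R by rewrite ltr0n.
apply: (@le_trans _ _ (expR (- (4 * Cst R * m%:R)^-1) ^+ (m ^ 2))).
  rewrite lerXn2r ?nnegrE ?expR_ge0//.
    by apply: sumr_ge0 => i _; exact: pvec_ge0.
  exact: le_trans (sum_pvec_le R m m0) (expR_ge1Dx _).
rewrite -expRM_natl ler_expR natrX le_eqVlt; apply/orP; left; apply/eqP.
by field; rewrite !lt0r_neq0.
Qed.

Lemma Pouter_bounded_infinitely_often (R : realType) :
  Pouter R [set om | forall M, exists2 m, (M <= m)%N &
                     forall k, (k < m ^ 2)%N -> (om k < m)%N] = 0%E.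
Proof.
set B := [set _ | _].
set r := expR (- (4 * Cst R)^-1).
have r0 : 0 < r := expR_gt0 _.
have r1 : r < 1 by rewrite expR_lt1 oppr_lt0 invr_gt0 mulr_gt0 ?Cst_gt0.
apply/eqP; rewrite eq_le; apply/andP; split; last first.
  apply: le_ereal_inf_tmp => _ [ws _ <-].
  by apply: nneseries_ge0 => j _ _; rewrite lee_fin cyl_prob_ge0.
apply/lee_addgt0Pr => e e0; rewrite add0e.
(* [M] is taken so large that the geometric tail [r ^ M / (1 - r)] is below [e]. *)
have /cvgrPdist_lt/(_ (e * (1 - r))) : r ^+ n @[n --> \oo] --> (0 : R).
  by apply: cvg_expr; rewrite ger0_norm ?ltW.
rewrite mulr_gt0 ?subr_gt0// => /(_ isT)[M _ /(_ M (leqnn M))].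
rewrite /= sub0r normrN ger0_norm ?exprn_ge0 ?(ltW r0)// => rM.
(* One list of words for each [m > M]. The filler word [[:: 0]] has probability zero since
   [pvec 0 = 0]. *)
have [|||ws [wsL _ wss]] := @sequence_of_lists R _ [:: 0%N]
  (fun k => words_below (M + k).+1 ((M + k).+1 ^ 2)) (cyl_prob R) e.
- exact: cyl_prob_ge0.
- by rewrite /cyl_prob big_seq1.
- move=> n.
  apply: (@le_trans _ _ (\sum_(k < n) r ^+ M * r ^+ k)).
    apply: ler_sum => k _; apply: (le_trans (sum_words_below_le R _ _)) => //.
    by rewrite -exprD exprS ler_piMl ?exprn_ge0 ?ltW.
  have -> : \sum_(k < n) r ^+ M * r ^+ k = series (geometric (r ^+ M) r) n.
    by rewrite /series/= big_mkord.
  apply: (le_trans (geometric_le_lim n _ _ _)) => //.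
  + by rewrite exprn_ge0 ?ltW.
  + by rewrite ger0_norm ?ltW.
  + by rewrite ler_pdivrMr ?subr_gt0// ltW.
apply: le_trans wss; apply: ereal_inf_lbound; exists ws => //= om /(_ M.+1)[m Mm omm].
have [|j wsj] := wsL (m - M.+1)%N (mkseq om (m ^ 2)).
  rewrite -addSn subnKC//; exact: mem_words_below.
exists j => //; rewrite wsj => k; rewrite size_mkseq => km.
by rewrite nth_mkseq.
Qed.

(** * Dyadic cells and their diameters *)

Lemma psi_word_cat (R : realType) (d : nat) (w1 w2 : seq (letter d)) (x : pt R d) :
  psi_word (w1 ++ w2) x = psi_word w1 (psi_word w2 x).
Proof. by elim: w1 => //= a w1 ->. Qed.

Lemma psi_word_sub (R : realType) (d : nat) (w : seq (letter d)) (x y : pt R d) l :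
  psi_word w x l - psi_word w y l = (x l - y l) * 2^-1 ^+ size w.
Proof.
elim: w => [|a w IH] /=; first by rewrite expr0 mulr1.
by rewrite /phi exprSr mulrA -IH; lra.
Qed.

Lemma psi_word_X (R : realType) (d : nat) (w : seq (letter d)) (x : pt R d) :
  X x -> X (psi_word w x).
Proof.
move=> Xx; elim: w => //= a w IH l; rewrite /phi.
by move: (IH l) => /andP[h0 h1]; apply/andP; case: (a l) => /=; lra.
Qed.

Lemma edist_psi_word_le (R : realType) (d : nat) (w : seq (letter d)) (x y : pt R d) :
  X x -> X y ->
  Defs.edist (psi_word w x) (psi_word w y) <= Num.sqrt d%:R * 2^-1 ^+ size w.
Proof.
move=> Xx Xy; have w0 : 0 <= 2^-1 ^+ size w :> R by rewrite exprn_ge0.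
have -> : 2^-1 ^+ size w = Num.sqrt ((2^-1 ^+ size w) ^+ 2) :> R.
  by rewrite sqrtr_sqr ger0_norm.
rewrite -sqrtrM// ler_wsqrtr//.
apply: (@le_trans _ _ (\sum_(l < d) (2^-1 ^+ size w) ^+ 2)).
  apply: ler_sum => l _; rewrite psi_word_sub exprMn ler_piMl ?sqr_ge0//.
  rewrite -real_normK ?num_real// expr_le1// ler_norml.
  by move: (Xx l) (Xy l) => /andP[? ?] /andP[? ?]; lra.
by rewrite sumr_const card_ord mulr_natl.
Qed.

(** * Bounding Hausdorff premeasures by finite covers with cells *)

Lemma cost_ge0 (R : realType) (d : nat) (s : R) (A : set (pt R d)) : 0 <= cost s A.
Proof. by rewrite /cost; case: pselect => //= _; rewrite powR_ge0. Qed.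

Lemma cost_set0 (R : realType) (d : nat) (s : R) : cost s (@set0 (pt R d)) = 0.
Proof. by rewrite /cost; case: pselect => //= -[x []]. Qed.

Lemma cost_le (R : realType) (d : nat) (s D : R) (A : set (pt R d)) :
  0 <= s -> 0 <= D -> (forall x y, A x -> A y -> Defs.edist x y <= D) ->
  cost s A <= D `^ s.
Proof.
move=> s0 D0 AD; rewrite /cost; case: pselect => /= [A0|_]; last exact: powR_ge0.
set E := [set _ | _ in _ & _ in _].
have ED : ubound E D by move=> _ [x Ax [y Ay <-]]; exact: AD.
have [x Ax] := A0.
have E0 : E (Defs.edist x x) by exists x => //; exists x.
apply: ge0_ler_powR; rewrite ?nnegrE//.
  apply: le_trans (ub_le_sup _ E0); first exact: sqrtr_ge0.
  by exists D.
by apply: ge_sup => //; exists (Defs.edist x x).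
Qed.

Lemma Hdelta_ge0 (R : realType) (d : nat) (s delta : R) (A : set (pt R d)) :
  (0 <= Hdelta s delta A)%E.
Proof.
apply: le_ereal_inf_tmp => _ [Us _ <-].
by apply: nneseries_ge0 => j _ _; rewrite lee_fin cost_ge0.
Qed.

Lemma Hdelta_le_words (R : realType) (d N : nat) (s delta e : R)
    (A : set (pt R d)) (ws : seq (seq (letter d))) :
  0 <= s ->
  (forall x, A x -> exists2 w, w \in ws & (psi_word w @` @X R d) x) ->
  (forall w, w \in ws -> (N <= size w)%N) ->
  Num.sqrt d%:R * 2^-1 ^+ N <= delta ->
  (size ws)%:R * (Num.sqrt d%:R * 2^-1 ^+ N) `^ s <= e ->
  (Hdelta s delta A <= e%:E)%E.
Proof.
move=> s0 Aws Nws Ndelta Ne; set D := Num.sqrt d%:R * _ in Ndelta Ne.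
have D0 : 0 <= D by rewrite mulr_ge0 ?sqrtr_ge0 ?exprn_ge0.
(* [None] encodes the empty set, whose cost is zero; it pads the finite cover to an infinite
   sequence. *)
pose cell (o : option (seq (letter d))) := oapp (fun w => psi_word w @` @X R d) set0 o.
have wsD w : w \in ws -> forall x y, cell (Some w) x -> cell (Some w) y ->
    Defs.edist x y <= D.
  move=> /Nws Nw _ _ [x Xx <-] [y Xy <-].
  apply: le_trans (edist_psi_word_le _ _ w x y Xx Xy) _.
  rewrite ler_wpM2l ?sqrtr_ge0//; apply: ler_wiXn2l => //; lra.
have [|||Us [UsL UsD Uss]] := @sequence_of_lists R _ None
  (fun m => if m == 0%N then [seq Some w | w <- ws] else [::])
  (fun o => cost s (cell o)) e.
- by move=> o; exact: cost_ge0.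
- exact: cost_set0.
- case=> [|n].
    by rewrite big_ord0; apply: le_trans Ne; rewrite mulr_ge0 ?powR_ge0.
  rewrite big_ord_recl/= [X in _ + X]big1 ?addr0 => [|i _]; last by rewrite big_nil.
  apply: (@le_trans _ _ (\sum_(w <- ws) D `^ s)); last first.
    by rewrite big_const_seq count_predT iter_addr_0 -mulr_natl.
  rewrite big_map !big_seq; apply: ler_sum => w wws.
  by apply: cost_le => //; exact: wsD.
apply: le_trans Uss; apply: ereal_inf_lbound; exists (cell \o Us) => //=; split.
  move=> x /Aws[w wws wx]; have [j Usj] : exists j, Us j = Some w.
    by apply: (UsL 0%N); rewrite map_f.
  by exists j => //=; rewrite Usj.
move=> j x y; have [->|[m]] := UsD j; first by [].
case: eqP => // _ /mapP[w wws ->] wx wy.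
exact: le_trans (wsD w wws x y wx wy) Ndelta.
Qed.

(** * Covering the limit set and its dimension *)

(** A cell of generation [k + 1] is enlarged by cutting its last word after the forced zeros. Only
    the first [k] words then remain to be counted, while the zeros still shrink the diameter. *)
Lemma Jset_sub (R : realType) (d : nat) (U V om : nat -> nat) (k : nat) x :
  Jset R d U V om x ->
  exists w : (\sum_(j < k) (U (om j) + V (om j)))%N.-tuple (letter d),
    (psi_word (w ++ nseq (U (om k)) (zero_letter d)) @` @X R d) x.
Proof.
move=> /(_ k.+1 isT)[ts [sts tsI] [y Xy <-]].
have sw : size (flatten (take k ts)) = (\sum_(j < k) (U (om j) + V (om j)))%N.
  rewrite size_flatten sumnE big_map (big_nth [::]) size_takel ?sts// big_mkord.
  apply: eq_bigr => j _; rewrite nth_take//.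
  by have /andP[/eqP] := tsI j (ltnW (ltn_ord j)).
have /andP[/eqP sk /all_pred1P zk] := tsI k (ltnSn k).
rewrite size_takel ?sk ?leq_addr// in zk.
exists (tcast sw (in_tuple (flatten (take k ts)))).
(* The discarded end of the last word is absorbed into the point of [X]. *)
exists (psi_word (drop (U (om k)) (nth [::] ts k)) y); first exact: psi_word_X.
rewrite val_tcast /= -zk -psi_word_cat -catA cat_take_drop.
have -> // : flatten ts = flatten (take k ts) ++ nth [::] ts k.
rewrite -{1}(cat_take_drop k ts) (drop_nth [::]) ?sts// drop_oversize ?sts//.
by rewrite flatten_cat /= cats0.
Qed.

(** Since [V n >= n * U n] and [U n >= 1], the sum [U n + V n] is at least [n + 1], and its cube is
    at most [U (n + 1)]. *)
Lemma frame_ge_cube (U V : nat -> nat) (n : nat) :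
  is_frame U V -> (0 < n)%N -> (n ^ 3 <= U n)%N.
Proof.
move=> [U1 UV]; case: n => // -[_|n _]; first by rewrite exp1n.
have [U0 _ nUV UV3] := UV n.+1 isT; apply: leq_trans UV3; rewrite leq_exp2r//.
by move: U0 nUV; nia.
Qed.

Lemma frame_le (U V : nat -> nat) (j m : nat) : is_frame U V -> (0 < j)%N ->
  (j < m)%N -> (U j + V j <= U m)%N.
Proof.
move=> [_ UV] j0; have UVS n : (0 < n)%N -> (U n + V n <= U n.+1)%N.
  move=> n0; have [U0 V0 _] := UV n n0; apply: leq_trans.
  by apply: leq_trans (leq_pexp2l (n2 := 3) _ (isT : 1 <= 3)%N); rewrite ?expn1 ?addn_gt0 ?U0.
elim: m => // m IH; rewrite ltnS leq_eqVlt => /orP[/eqP<-|jm]; first exact: UVS.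
apply: leq_trans (IH jm) _; apply: leq_trans (UVS m (leq_trans j0 (ltnW jm))).
exact: leq_addr.
Qed.

(* With [W = U_p + V_p], all words before the first letter [om k > p] have length
   at most [W] (also the junk index [0], once [p] is large), whereas the next word
   starts with at least [W ^ 3] zeros. *)
Lemma Hdelta_Jset_le (R : realType) (d : nat) (U V om : nat -> nat) (p k : nat)
    (s delta e : R) :
  is_frame U V -> 0 < s -> 0 < delta -> 0 < e ->
  (0 < p)%N -> (U 0 + V 0 <= p)%N -> d.+1%:R / s <= p%:R ->
  Num.sqrt d%:R `^ s / e <= p%:R -> Num.sqrt d%:R / delta <= p%:R ->
  (k < p.+1 ^ 2)%N -> (forall j, (j < k)%N -> (om j <= p)%N) -> (p < om k)%N ->
  (Hdelta s delta (Jset R d U V om) <= e%:E)%E.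
Proof.
move=> fr s0 delta0 e0 p0 UV0 ps pe pdelta kp jk pk.
have [_ UVp] := fr; have [_ _ pUV UV3] := UVp p p0; have pU : (p <= U p)%N.
  by apply: leq_trans (frame_ge_cube U V p fr p0); rewrite -{1}(expn1 p) leq_pexp2l.
set W := (U p + V p)%N in UV3.
have W3 : (W ^ 3 <= U (om k))%N.
  move: pk; rewrite leq_eqVlt => /orP[/eqP<-//|pk].
  by apply: leq_trans UV3 _; apply: leq_trans (frame_le U V p.+1 (om k) fr _ pk); rewrite ?leq_addr.
(* Squared, this bound lets [s * W ^ 2] dominate the factor [(p + 1) ^ 2] of [LW] in the final
   comparison of exponents. *)
have pW : (p * p.+1 <= W)%N.
  by rewrite mulnS leq_add// (leq_trans _ pUV)// leq_mul.
have pW' : (p <= W)%N by apply: leq_trans pW; rewrite leq_pmulr.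
set L := (\sum_(j < k) (U (om j) + V (om j)))%N.
have LW : (L <= p.+1 ^ 2 * W)%N.
  apply: (@leq_trans (k * W)%N); last by rewrite leq_mul2r ltnW ?orbT.
  rewrite -[in leqRHS](card_ord k) -sum_nat_const; apply: leq_sum => j _.
  have := jk j (ltn_ord j); case: (posnP (om j)) => [-> _|j0]; first exact: leq_trans pW'.
  rewrite leq_eqVlt => /orP[/eqP->//|jp].
  by apply: leq_trans (frame_le U V _ p fr j0 jp) (leq_addr _ _).
have Wp : p%:R <= W%:R :> R by rewrite ler_nat.
have half_W n : (2^-1 ^+ n : R) * n%:R <= 1.
  have le2n : (n <= 2 ^ n)%N by apply: ltnW; exact: ltn_expl.
  by rewrite exprVn mulrC ler_pdivrMr ?exprn_gt0// mul1r -natrX ler_nat.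
have pR : 0 < p%:R :> R by rewrite ltr0n.
have WR : 0 < W%:R :> R := lt_le_trans pR Wp.
pose ws := [seq tval w ++ nseq (U (om k)) (zero_letter d) | w <- enum {: L.-tuple (letter d)}].
apply: (Hdelta_le_words R d (W ^ 3)%N s delta e _ ws (ltW s0)).
- move=> x /(@Jset_sub _ _ _ _ _ k)[w wx].
  by exists (tval w ++ nseq (U (om k)) (zero_letter d)) => //; apply: map_f; rewrite mem_enum.
- by move=> _ /mapP[w _ ->]; rewrite size_cat size_nseq; apply: leq_trans W3 (leq_addl _ _).
- rewrite ler_pdivrMr// in pdelta.
  have : 2^-1 ^+ (W ^ 3)%N <= 2^-1 ^+ W :> R.
    by apply: ler_wiXn2l; [lra|lra|rewrite -{1}(expn1 W) leq_pexp2l// (leq_trans p0)].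
  have := half_W W; have : 0 <= 2^-1 ^+ W :> R by rewrite exprn_ge0.
  have := sqrtr_ge0 (d%:R : R).
  move: (Num.sqrt _) pdelta (2^-1 ^+ W : R) (2^-1 ^+ (W ^ 3)%N : R) => q qp h h1 q0 h0 hW h1h.
  apply: (@le_trans _ _ (q * h)); first exact: ler_wpM2l.
  apply: (@le_trans _ _ (p%:R * delta * h)); first by rewrite ler_wpM2r.
  rewrite mulrAC ler_piMl ?(ltW delta0)//; apply: le_trans hW.
  by rewrite mulrC ler_wpM2l.
rewrite size_map -cardE card_tuple card_ffun card_bool card_ord.
rewrite powRM ?sqrtr_ge0 ?exprn_ge0// mulrCA.
rewrite ler_pdivrMr// in pe.
(* The factor [(sqrt d) ^ s] is at most [p * e], and the remaining [2^(d L) * 2^(-s W^3)] will be at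
   most [2^(-W)]; finally [p * 2^(-W) <= 1]. *)
apply: (@le_trans _ _ (p%:R * e * 2^-1 ^+ W)); last first.
  rewrite mulrAC ler_piMl ?(ltW e0)//; apply: le_trans (half_W W).
  by rewrite mulrC ler_wpM2l ?exprn_ge0.
apply: ler_pM => //; rewrite ?powR_ge0 ?mulr_ge0 ?powR_ge0// 1?mulrC//.
have halfE n : 2^-1 ^+ n = 2 `^ (- n%:R) :> R by rewrite powRN powR_mulrn// exprVn.
have -> : ((2 ^ d) ^ L)%:R = 2 `^ (d * L)%:R :> R.
  by rewrite -expnM natrX powR_mulrn.
rewrite !halfE -powRrM -powRD; last by rewrite pnatr_eq0 implybT.
rewrite ler_powR ?ler1n//.
have LWR : L%:R <= (p%:R + 1) ^+ 2 * W%:R :> R.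
  by rewrite natr1 -natrX -natrM ler_nat.
have pWR : p%:R * (p%:R + 1) <= W%:R :> R by rewrite natr1 -natrM ler_nat.
rewrite ler_pdivrMr// in ps.
have p1 : 1 <= p%:R :> R by rewrite ler1n.
rewrite natrM natrX; rewrite -natr1 in ps.
have d0 : 0 <= d%:R :> R by [].
(* What remains is [D l - s w^3 <= -w]. In [(D + 1) (P + 1)^2 w <= s w^3] the summand [D] pays for
   [D l] and the extra 1 pays for [w]. *)
move: (p%:R : R) (W%:R : R) (L%:R : R) (d%:R : R) p1 pR WR d0 LWR pWR ps => P w l D *.
have h1 : D * l <= D * ((P + 1) ^+ 2 * w) by apply: ler_wpM2l.
have h2 : (P * (P + 1)) ^+ 2 <= w ^+ 2.
  by rewrite lerXn2r// nnegrE ?mulr_ge0//; lra.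
have h3 : D + 1 <= s * P ^+ 2.
  apply: (@le_trans _ _ (P * s)) => //; rewrite mulrC ler_pM2l// expr2 ler_peMr//; lra.
have h4 : (D + 1) * (P + 1) ^+ 2 <= s * w ^+ 2.
  apply: (@le_trans _ _ (s * P ^+ 2 * (P + 1) ^+ 2)).
    by rewrite ler_wpM2r ?exprn_ge0//; lra.
  by rewrite -mulrA -exprMn ler_pM2l.
have h5 : 1 <= (P + 1) ^+ 2 by rewrite expr2; nra.
have h6 : (D + 1) * (P + 1) ^+ 2 * w <= s * w ^+ 2 * w by rewrite ler_pM2r.
have h7 : w <= (P + 1) ^+ 2 * w by rewrite ler_peMl// ltW.
have -> : - w ^+ 3 * s = - (s * w ^+ 2 * w) by ring.
by lra.
Qed.

Lemma dimH_Jset0 (R : realType) (d : nat) (U V om : nat -> nat) (M : nat) :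
  is_frame U V ->
  (forall m, (M <= m)%N -> exists2 k, (k < m ^ 2)%N & (m <= om k)%N) ->
  dimH R d (Jset R d U V om) = 0%E.
Proof.
move=> fr omM; apply/eqP; rewrite eq_le; apply/andP; split; last first.
  by apply: le_ereal_inf_tmp => _ [s [s0 _] <-]; rewrite lee_fin.
apply/lee_addgt0Pr => s s0; rewrite add0e; apply: ereal_inf_lbound.
exists s => //; split; first exact: ltW.
apply/eqP; rewrite eq_le; apply/andP; split; last first.
  apply: (@le_trans _ _ (Hdelta s 1 (Jset R d U V om))); first exact: Hdelta_ge0.
  by apply: ereal_sup_ubound; exists 1 => //=.
apply: ge_ereal_sup => _ [delta /= delta0 <-].
apply/lee_addgt0Pr => e e0; rewrite add0e.
have bd0 (x : R) : 0 <= x -> exists n, x <= n%:R.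
  by move=> x0; exists (Num.bound x); rewrite ltW// archi_boundP.
have [n1 n1P] : exists n, d.+1%:R / s <= n%:R by apply: bd0; rewrite divr_ge0// ltW.
have [n2 n2P] : exists n, Num.sqrt d%:R `^ s / e <= n%:R.
  by apply: bd0; rewrite divr_ge0 ?powR_ge0// ltW.
have [n3 n3P] : exists n, Num.sqrt d%:R / delta <= n%:R.
  by apply: bd0; rewrite divr_ge0 ?sqrtr_ge0// ltW.
(* Beyond every threshold of [Hdelta_Jset_le], and beyond [M]. *)
pose p := (M + (U 0 + V 0) + n1 + n2 + n3).+1%N.
have le_p n : (n <= p)%N -> n%:R <= p%:R :> R by rewrite ler_nat.
have om_gt : exists k, (p < om k)%N.
  by have [|k _ pk] := omM p.+1; [rewrite /p; lia|exists k].
(* First position of a letter above [p]: minimality bounds all earlier letters by [p], and the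
   hypothesis at [p + 1] yields [k < (p + 1) ^ 2]. *)
case: (ex_minnP om_gt) => k pk kmin.
apply: (Hdelta_Jset_le R d U V om p k) => //.
- by rewrite /p; lia.
- by apply: le_trans n1P _; apply: le_p; rewrite /p; lia.
- by apply: le_trans n2P _; apply: le_p; rewrite /p; lia.
- by apply: le_trans n3P _; apply: le_p; rewrite /p; lia.
- have [|k' k'p pk'] := omM p.+1; first by rewrite /p; lia.
  exact: leq_ltn_trans (kmin _ pk') k'p.
- by move=> j; rewrite ltnNge [(om j <= p)%N]leqNgt; apply: contra => /kmin.
Qed.

(** * The Bowen parameter *)

(** The first [U i] letters are forced, so dropping them is a bijection onto the free words of
    length [V i]; all summands are equal. *)
Lemma level_sumE (R : realType) (d : nat) (U V : nat -> nat) (i : nat) (t : R) :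
  level_sum d U V i t = ((2 ^ d) ^ V i)%:R * cratio R U V i `^ t.
Proof.
rewrite /level_sum sumr_const mulr_natl; congr (_ *+ _).
pose f (w : (V i).-tuple (letter d)) : (U i + V i).-tuple (letter d) :=
  [tuple of nseq (U i) (zero_letter d) ++ w].
have f_inj : injective f.
  by move=> w w' /(congr1 val)/eqP; rewrite /= eqseq_cat// eqxx => /eqP/val_inj.
have -> : ((2 ^ d) ^ V i)%N = #|[set: (V i).-tuple (letter d)]%SET|.
  by rewrite cardsT card_tuple card_ffun card_bool card_ord.
rewrite -(card_imset _ f_inj); apply: eq_card => w; rewrite unfold_in; apply/idP/imsetP.
  move=> /all_pred1P; rewrite size_takel ?size_tuple ?leq_addr// => wz.
  have sw : size (drop (U i) w) == V i by rewrite size_drop size_tuple addKn.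
  exists (Tuple sw); rewrite ?inE//; apply: val_inj => /=.
  by rewrite -wz cat_take_drop.
by move=> [w' _ ->]; rewrite /= take_size_cat ?size_nseq// all_pred1_nseq.
Qed.

Lemma ln_level_sum (R : realType) (d : nat) (U V : nat -> nat) (i : nat) (t : R) :
  ln (level_sum d U V i t) =
  ln 2 * (d%:R * (V i)%:R - t * ((U i)%:R + (V i)%:R)).
Proof.
have c0 : 0 < cratio R U V i by rewrite exprn_gt0.
rewrite level_sumE lnM ?posrE ?powR_gt0 ?ltr0n ?expn_gt0// -expnM natrX lnXn//.
rewrite ln_powR /cratio lnXn// lnV ?posrE//.
by rewrite -[ln 2 *+ _]mulr_natr -[(- ln 2) *+ _]mulr_natr natrM natrD; ring.
Qed.

(** At [t = d] the logarithm is [- ln 2 * d * U_i], so the partial sums decrease and have a limit in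
    [[-oo, 0]]. *)
Lemma bowen_cond_d (R : realType) (d : nat) (U V : nat -> nat) :
  bowen_cond d U V (d%:R : R).
Proof.
set u := fun i => (pvec R i * ln (level_sum d U V i d%:R))%:E.
have u0 i : (u i <= 0)%E.
  rewrite lee_fin ln_level_sum mulr_ge0_le0 ?pvec_ge0//.
  rewrite mulr_ge0_le0 ?ln_ge0 ?ler1n//.
  have -> : d%:R * (V i)%:R - d%:R * ((U i)%:R + (V i)%:R) = - (d%:R * (U i)%:R) :> R.
    by ring.
  by rewrite oppr_le0 mulr_ge0.
have cu : cvgn (fun n => \sum_(1 <= i < n) u i)%E.
  by apply: is_cvg_npeseries => n _ _.
exists (limn (fun n => \sum_(1 <= i < n) u i)%E); split => //.
by apply: lime_le => //; apply: nearW => n; apply: sume_le0.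
Qed.

Lemma bowen_cond_ge (R : realType) (d : nat) (U V : nat -> nat) (t : R) :
  is_frame U V -> 0 <= t -> bowen_cond d U V t -> d%:R <= t.
Proof.
move=> fr t0 [l [ul l0]]; rewrite leNgt; apply/negP => td.
set u : nat -> R := fun i => pvec R i * ln (level_sum d U V i t).
have C0 := Cst_gt0 R; have ln0 : 0 < ln 2 :> R by rewrite ln_gt0// ltr1n.
have [N uN] : exists N, forall i, (N < i)%N -> 1 <= u i.
  (* The first bound gives [(d - t) V_i - t U_i >= U_i] through [V_i >= i U_i]. The second gives
     [ln 2 * U_i >= ln 2 * i^3 >= C i^2], which cancels [p_i]. *)
  exists (Num.bound ((t + 1) / (d%:R - t)) + Num.bound (Cst R / ln 2))%N => i Ni.
  have i1 : (t + 1) / (d%:R - t) <= i%:R.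
    apply: (@le_trans _ _ (Num.bound ((t + 1) / (d%:R - t)))%:R).
      by rewrite ltW// archi_boundP// divr_ge0//; lra.
    by rewrite ler_nat; lia.
  have i2 : Cst R / ln 2 <= i%:R.
    apply: (@le_trans _ _ (Num.bound (Cst R / ln 2))%:R).
      by rewrite ltW// archi_boundP// divr_ge0// ltW.
    by rewrite ler_nat; lia.
  have i0 : (0 < i)%N by lia.
  have [_ /(_ i i0)[_ _ iUV _]] := fr.
  have : i%:R ^+ 3 <= (U i)%:R :> R by rewrite -natrX ler_nat (frame_ge_cube U V).
  have : i%:R * (U i)%:R <= (V i)%:R :> R by rewrite -natrM ler_nat.
  rewrite /u ln_level_sum /pvec gtn_eqF//.
  have : 0 < i%:R :> R by rewrite ltr0n.
  move: i1 i2; rewrite ler_pdivrMr ?subr_gt0// ler_pdivrMr//.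
  move: (i%:R : R) (U i)%:R (V i)%:R => x a b x1 x2 x0 xab xa.
  have a0 : 0 < a by apply: lt_le_trans xa; rewrite exprn_gt0.
  have h1 : (d%:R - t) * (x * a) <= (d%:R - t) * b by rewrite ler_wpM2l// subr_ge0 ltW.
  have h2 : (t + 1) * a <= x * (d%:R - t) * a by rewrite ler_pM2r.
  have h3 : a <= d%:R * b - t * (a + b) by lra.
  rewrite mulrC ler_pdivlMr ?mulr_gt0 ?exprn_gt0// mul1r.
  apply: (@le_trans _ _ (ln 2 * x ^+ 3)).
    have -> : ln 2 * x ^+ 3 = x * ln 2 * x ^+ 2 by ring.
    by rewrite ler_pM2r ?exprn_gt0.
  by rewrite ler_pM2l// (le_trans xa).
have sumN n : \sum_(1 <= i < N.+1) u i + n%:R <= \sum_(1 <= i < N.+1 + n) u i.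
  elim: n => [|n IH]; first by rewrite addn0 addr0.
  rewrite addnS -natr1 [leRHS]big_nat_recr//= addrA lerD// uN//.
  by rewrite addSn ltnS leq_addr.
have uy : (\sum_(1 <= i < n) (u i)%:E)%E @[n --> \oo] --> +oo%E.
  apply/cvgeyPge => A.
  have [K AK] : exists K : nat, A - \sum_(1 <= i < N.+1) u i <= K%:R.
    by exists (Num.bound `|A - \sum_(1 <= i < N.+1) u i|);
      apply: le_trans (ler_norm _) _; rewrite ltW// archi_boundP.
  exists (N.+1 + K)%N => // n /= nK; rewrite sumEFin lee_fin.
  rewrite -(subnKC nK) -addnA; apply: le_trans (sumN _).
  by rewrite -lerBlDl; apply: le_trans AK _; rewrite ler_nat leq_addr.
have ly : l = +oo%E by apply: cvg_unique ul uy.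
by rewrite ly in l0.
Qed.

Lemma Bowen_frame (R : realType) (d : nat) (U V : nat -> nat) :
  is_frame U V -> Bowen R d U V = (d%:R)%:E.
Proof.
move=> fr; apply/eqP; rewrite eq_le; apply/andP; split.
  by apply: ereal_inf_lbound; exists d%:R => //; split => //; exact: bowen_cond_d.
apply: le_ereal_inf_tmp => _ [t [t0 tB] <-]; rewrite lee_fin.
exact: bowen_cond_ge fr t0 tB.
Qed.

Theorem theorem2p5 (R : realType) (d : nat) (U V : nat -> nat) :
  (1 <= d)%N -> is_frame U V ->
  Bowen R d U V = (d%:R)%:E /\
  almost_surely R (fun om => dimH R d (Jset R d U V om) = 0%E /\
                           (dimH R d (Jset R d U V om) < Bowen R d U V)%E).
Proof.
move=> d1 fr; have Bd := Bowen_frame R d U V fr; split => //.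
apply/eqP; rewrite eq_le; apply/andP; split; last first.
  apply: le_ereal_inf_tmp => _ [ws _ <-].
  by apply: nneseries_ge0 => j _ _; rewrite lee_fin cyl_prob_ge0.
(* Monotonicity of the outer measure: an exceptional [om] has, for arbitrarily large [m], its first
   [m^2] letters all below [m]. *)
rewrite -[leRHS](Pouter_bounded_infinitely_often R).
apply: ereal_inf_le_tmp => _ [ws cov <-]; exists ws => // om /= omJ; apply: cov.
move=> M /=; apply: contrapT => omM; apply: omJ.
(* Strictness is [0 < d], which is where [1 <= d] enters. *)
suff J0 : dimH R d (Jset R d U V om) = 0%E by rewrite J0 Bd lte_fin ltr0n.
apply: (dimH_Jset0 R d U V om M fr) => m Mm; apply: contrapT => nk.
apply: omM; exists m => // k km; rewrite ltnNge; apply/negP => mk.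
by apply: nk; exists k.
Qed.
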